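(* For all $x,y\in\mathbb{Z}^2\setminus\{0\}$, the Green's function $\widehat{G}$ of the conditioned walk $\widehat{S}$ satisfies $$\widehat{G}(x,y)=\frac{a(y)}{a(x)}\big(a(x)+a(y)-a(x-y)\big).$$
   Context: Let $(S_n,n\ge 0)$ be the simple random walk on $\mathbb{Z}^2$, $\mathbb{P}_x$ its law started from $x$, and $\mathbb{E}_x$ the corresponding expectation; $x\sim y$ means that $x,y\in\mathbb{Z}^2$ are nearest neighbours. The potential kernel is $a(x)=\sum_{k=0}^{\infty}\big(\mathbb{P}_0[S_k=0]-\mathbb{P}_x[S_k=0]\big)$, $x\in\mathbb{Z}^2$. (The series converges, $a(0)=0$, $a(x)>0$ for $x\ne 0$, and $a(x)=\frac14\sum_{y\sim x}a(y)$ for $x\neq 0$.) The conditioned walk $(\widehat{S}_n,n\ge 0)$ is the Markov chain on $\mathbb{Z}^2\setminus\{0\}$ with transition probabilities $\widehat{P}(x,y)=\frac{a(y)}{4a(x)}$ if $x\sim y$, $x\ne0$, and $\widehat{P}(x,y)=0$ otherwise. When applied to $\widehat{S}$, $\mathbb{P}_x$ and $\mathbb{E}_x$ denote the law and expectation for $\widehat{S}$ started from $x$. The Green's function of $\widehat{S}$ is $\widehat{G}(x,y)=\mathbb{E}_x\sum_{k=0}^{\infty}\mathbf{1}\{\widehat{S}_k=y\}$ for $x,y\in\mathbb{Z}^2\setminus\{0\}$. *)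

(* Defs.v *)
From HB Require Import structures.
From mathcomp Require Import all_boot all_order all_algebra.
From mathcomp Require Import all_classical all_reals all_analysis.
Import Order.TTheory GRing.Theory Num.Theory.
Import numFieldNormedType.Exports.
Set Implicit Arguments.
Unset Strict Implicit.
Unset Printing Implicit Defensive.
Local Open Scope classical_set_scope.
Local Open Scope ring_scope.

Notation Z2 := (int * int)%type.

Definition Z2star := {x : Z2 | x != 0}.

Definition neighbour (x y : Z2) : bool :=
  `|x.1 - y.1| + `|x.2 - y.2| == 1 :> int.

Definition path_event (T : Type) (E : Type) (S : nat -> T -> E)
    (n : nat) (s : nat -> E) : set T :=
  [set w | forall k, (k <= n)%N -> S k w = s k].

(* [P x] is the law under which the common process [S] starts from [x].  The
   last clause is the Markov property
     P_x[S_{n+1} = s_{n+1} | S_0 = s_0, ..., S_n = s_n] = p(s_n, s_{n+1}),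
   multiplied by the probability of the conditioning event (which may be 0).
   As [E] is countable, the first clause says that each [S n] is measurable
   for the discrete sigma-algebra on [E]. *)
Definition markov_chain (R : realType) (E : countType) (p : E -> E -> R)
    (d : measure_display) (T : measurableType d)
    (P : E -> probability T R) (S : nat -> T -> E) : Prop :=
  [/\ forall n z, measurable (S n @^-1` [set z]),
      forall x, P x (S 0%N @^-1` [set x]) = 1%E
    & forall x n (s : nat -> E),
        P x (path_event S n.+1 s)
        = (P x (path_event S n s) * (p (s n) (s n.+1))%:E)%E].

Definition srw_kernel (R : realType) (x y : Z2) : R :=
  if neighbour x y then 4^-1 else 0.

Definition simple_random_walk (R : realType) (d : measure_display)
    (T : measurableType d) (P : Z2 -> probability T R) (S : nat -> T -> Z2) :
    Prop :=
  markov_chain (@srw_kernel R) P S.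

(* The series need not converge absolutely (parity of [S k]), so its sum is the
   limit of the partial sums over k < n. *)
Definition potential_kernel (R : realType) (d : measure_display)
    (T : measurableType d) (P : Z2 -> probability T R) (S : nat -> T -> Z2)
    (x : Z2) : R :=
  limn (series (fun k => fine (P 0 (S k @^-1` [set 0]))
                         - fine (P x (S k @^-1` [set 0])))).

Definition conditioned_kernel (R : realType) (a : Z2 -> R) (x y : Z2star) : R :=
  if neighbour (val x) (val y) then a (val y) / (4 * a (val x)) else 0.

Definition conditioned_walk (R : realType) (a : Z2 -> R) (d : measure_display)
    (T : measurableType d) (P : Z2star -> probability T R)
    (S : nat -> T -> Z2star) : Prop :=
  markov_chain (conditioned_kernel a) P S.

Definition green (R : realType) (E : countType) (d : measure_display)
    (T : measurableType d) (P : E -> probability T R) (S : nat -> T -> E)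
    (x y : E) : \bar R :=
  (\int[P x]_w \sum_(0 <= k <oo) (\1_(S k @^-1` [set y]) w)%:E)%E.

(* Main.v *)
Require Import Defs.
From mathcomp Require Import all_boot all_order all_algebra.
From mathcomp Require Import all_classical all_reals all_analysis.
From mathcomp Require Import measurable_realfun zify ring lra.
Import Order.TTheory GRing.Theory Num.Theory.
Import numFieldNormedType.Exports.
Local Open Scope classical_set_scope.
Local Open Scope ring_scope.
Set Implicit Arguments.
Unset Strict Implicit.
Unset Printing Implicit Defensive.

(** The conditioned walk is the Doob transform, by the potential kernel [a], of
    the simple random walk killed at the origin. Along a path that avoids the
    origin, the factors a(z')/a(z) of the transition probabilities telescope,
    so the n-step probabilities from x to y are those of the killed walk times
    a(y)/a(x) ([conditioned_nstep_prob]). Since [a] is positive off the origin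
    ([potential_gt0]), it remains to see that the killed walk started at x makes
    a(x) + a(y) - a(x - y) visits to y on average ([sum_killed_prob_cvg]).

    Write p_k(x) for the probability that the walk started at x is at 0 at time
    k, G_N(x) for the sum of the p_k(x) over k < N, a_N(x) = G_N(0) - G_N(x) for
    the partial sums of [a], and f_j(x) for the probability that the walk
    started at x first visits 0 at time j. Splitting at the first visit to 0,
    the visits to y number
      G_N(x - y) = (visits of the killed walk) + sum_j f_j(x) G_{N-j}(y),
    and the same identity for y = 0 reads G_N(x) = sum_j f_j(x) G_{N-j}(0).
    Expressing G through a_N makes the divergent terms G_N(0) cancel:
      (visits of the killed walk)
        = a_N(x) - a_N(x - y) + sum_j f_j(x) a_{N-j}(y).
    The convolution tends to a(y) because the f_j(x) sum to 1, that is, because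
    the walk is recurrent ([convolution_cvg], [sum_hit_prob_cvg1]).

    Convergence of a_N uses parity and a Harnack-type bound. On even sites the
    terms p_k(0) - p_k(x) are nonnegative, so a_N(x) increases with N. It is
    bounded because a_{N+1}(x) is, up to a bounded error, the average of a_N
    over the neighbours of x, which propagates bounds from 0 to the whole
    lattice. Odd sites follow by averaging, since p_N(0) tends to 0.

    The inputs on p_N(0), namely p_N(0) -> 0 and divergence of the sum of the
    p_N(0), come from the fact that the coordinates x1 + x2 and x1 - x2 of the
    walk are two independent walks on the integers ([ret_prob_line]), whose
    probability of being at 0 at time 2n has square between 1/(4n+1) and
    1/(2n+1). *)

(** * Convolution with a probability distribution *)

Section Convolution.
Variable R : realType.
Implicit Types f b d : nat -> R.

Lemma sum_convolution f b N :
  \sum_(0 <= n < N) \sum_(0 <= j < n.+1) f j * b (n - j)%N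
  = \sum_(0 <= j < N) f j * \sum_(0 <= k < N - j) b k.
Proof.
elim: N => [|N IH]; first by rewrite !big_geq.
rewrite big_nat_recr //= IH [in RHS]big_nat_recr //= subSn // subnn big_nat1.
rewrite [in LHS]big_nat_recr //= subnn addrA -big_split /=; congr (_ + _).
rewrite !big_nat; apply: eq_bigr => j /andP[_ jN].
by rewrite -mulrDr subSn 1?ltnW // big_nat_recr.
Qed.

(** Most of the mass of [f] sits at small [j], where [d (N - j)] is close to its
    limit; the remaining mass is small and meets bounded values of [d]. *)
Lemma convolution_cvg f d (l : R) :
  (forall j, 0 <= f j) ->
  \sum_(0 <= j < N) f j @[N --> \oo] --> (1 : R) ->
  d m @[m --> \oo] --> l ->
  \sum_(0 <= j < N) f j * d (N - j)%N @[N --> \oo] --> l.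
Proof.
move=> f0 f1 dl.
have fle1 N : \sum_(0 <= j < N) f j <= 1.
  rewrite -(cvg_lim _ f1) //; apply: (@nondecreasing_cvgn_le _ (fun N => _)).
    by apply/nondecreasing_seqP => n; rewrite big_nat_recr //= lerDl.
  exact: cvgP f1.
have [B B0 dB] : exists2 B, 0 < B & forall m, `|d m - l| <= B.
  have dl0 : d m - l @[m --> \oo] --> l - l.
    by apply: cvgB => //; exact: cvg_cst.
  have [B HB] := cvg_has_ub (cvgP _ dl0).
  exists (Num.max B 1); first by rewrite lt_max ltr01 orbT.
  by move=> m; rewrite le_max; apply/orP; left; apply: HB => /=; exists m.
suff H : \sum_(0 <= j < N) f j * (d (N - j)%N - l) @[N --> \oo] --> (0 : R).
  have -> : l = 0 + 1 * l by rewrite add0r mul1r.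
  rewrite (_ : (fun N => _) = (fun N =>
      \sum_(0 <= j < N) f j * (d (N - j)%N - l) + (\sum_(0 <= j < N) f j) * l)); last first.
    apply/funext => N; rewrite mulr_suml -big_split /=.
    by apply: eq_bigr => j _; rewrite mulrBr subrK.
  by apply: cvgD => //; apply: cvgMl.
apply/cvgr0Pnorm_le => e e0.
have e2 : 0 < e / 2 by rewrite divr_gt0.
have [M _ HM] : \forall m \near \oo, `|l - d m| <= e / 2.
  by move/cvgrPdist_le : dl; apply.
have [K _ HK] : \forall N \near \oo, `|1 - \sum_(0 <= j < N) f j| <= e / 2 / B.
  by move/cvgrPdist_le : f1; apply; rewrite divr_gt0.
exists (K + M)%N => // N /= KMN.
rewrite (le_trans (ler_norm_sum _ _ _)) //.
(* For j < N - M the index N - j exceeds M; the other j are at least K. *)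
rewrite (@big_cat_nat _ _ _ (N - M)) //= ?leq_subr //.
have S1 : \sum_(0 <= j < N - M) `|f j * (d (N - j)%N - l)| <= e / 2.
  apply: (@le_trans _ _ (\sum_(0 <= j < N - M) f j * (e / 2))).
    rewrite !big_nat; apply: ler_sum => j /andP[_ jN].
    rewrite normrM ger0_norm // ler_wpM2l // distrC; apply: HM => /=; lia.
  by rewrite -mulr_suml ler_piMl // ltW.
have S2 : \sum_(N - M <= j < N) `|f j * (d (N - j)%N - l)| <= e / 2.
  apply: (@le_trans _ _ (\sum_(N - M <= j < N) f j * B)).
    by apply: ler_sum => j _; rewrite normrM ger0_norm // ler_wpM2l.
  rewrite -mulr_suml -ler_pdivlMr //.
  have NMK : (K <= N - M)%N by lia.
  apply: le_trans (HK _ NMK); rewrite ger0_norm ?subr_ge0 //.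
  have := fle1 N; rewrite (@big_cat_nat _ _ _ (N - M)) //= ?leq_subr //.
  lra.
by rewrite [leRHS]splitr lerD.
Qed.

End Convolution.

(** * The simple random walk on the integers *)

Section Line.
Variable R : realType.

Fixpoint line_prob (n : nat) (u : int) : R :=
  if n is m.+1 then (line_prob m (u - 1) + line_prob m (u + 1)) / 2
  else (u == 0)%:R.

Arguments line_prob n%_N u%_R.

Lemma line_prob_ge0 n u : 0 <= line_prob n u.
Proof.
elim: n u => [|n IH] u /=; first by rewrite ler0n.
by rewrite divr_ge0 // addr_ge0.
Qed.

Lemma line_probN n u : line_prob n (- u) = line_prob n u.
Proof.
elim: n u => [|n IH] u /=; first by rewrite oppr_eq0.
by rewrite addrC -(IH (u - 1)) -(IH (u + 1)) opprB opprD [- u + 1]addrC.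
Qed.

(** The ratio of consecutive binomial coefficients C(n, k+1)/C(n, k), in terms
    of the position u = 2k - n. In this form it is stable under the recursion
    defining [line_prob], whatever the parity and sign of [u]; unimodality and
    the size of the central value both follow from it. *)
Lemma line_prob_ratio n u :
  (n%:Z + u + 2)%:~R * line_prob n (u + 2) = (n%:Z - u)%:~R * line_prob n u.
Proof.
elim: n u => [|n IH] u /=.
  have [->|u0] := eqVneq u 0; first by rewrite subrr mul0r !add0r mulr0.
  have [u2|_] := eqVneq (u + 2) 0; last by rewrite !mulr0.
  by rewrite add0r u2 mul0r mulr0.
have := IH (u - 1); have := IH (u + 1).
rewrite -[n.+1]addn1 PoszD.
rewrite (_ : u - 1 + 2 = u + 1); last by ring.
rewrite (_ : u + 1 + 2 = u + 2 + 1); last by ring.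
rewrite (_ : u + 2 - 1 = u + 1); last by ring.
move: (line_prob n (u - 1)) (line_prob n (u + 1)) (line_prob n (u + 2 + 1)).
move=> A B C; rewrite !(intrD, intrB); move: n%:~R u%:~R => N U H1 H2.
lra.
Qed.

Lemma line_prob_parity n u : ~~ (2 %| n%:Z + u)%Z -> line_prob n u = 0.
Proof.
elim: n u => [|n IH] u /=; first by rewrite add0r; case: eqP => // ->.
by move=> h; rewrite !IH ?addr0 ?mul0r//; lia.
Qed.

Lemma line_prob_step_le n u : -1 <= u -> line_prob n (u + 2) <= line_prob n u.
Proof.
move=> u1; have := line_prob_ratio n u.
have : line_prob n (u + 2) >= 0 by exact: line_prob_ge0.
have : line_prob n u >= 0 by exact: line_prob_ge0.
have : (0:R) < (n%:Z + u + 2)%:~R by rewrite ltr0z; lia.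
have : ((n%:Z - u)%:~R : R) <= (n%:Z + u + 2)%:~R by rewrite ler_int; lia.
move: (line_prob n (u + 2)) (line_prob n u) (n%:Z - u)%:~R (n%:Z + u + 2)%:~R.
move=> A B b a ba a0 B0 A0 E.
by rewrite -(ler_pM2l a0) E ler_wpM2r.
Qed.

Lemma line_prob_le_centre n u : ~~ odd n -> line_prob n u <= line_prob n 0.
Proof.
move=> n2; wlog u0 : u / 0 <= u.
  move=> H; have [/H//|u0] := leP 0 u.
  by rewrite -line_probN; apply: H; rewrite oppr_ge0 ltW.
case: u u0 => [m|//] _.
have [m2|m2] := boolP (odd m).
  by rewrite line_prob_parity ?line_prob_ge0//; lia.
rewrite -(even_halfK m2); elim: (m./2) => [//|k IH].
apply: le_trans IH; rewrite (_ : Posz k.+1.*2 = k.*2%:Z + 2); last by lia.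
exact: line_prob_step_le.
Qed.

Lemma line_prob_centreSS n :
  line_prob n.+2 0 = line_prob n 0 * (n.+1%:R / n.+2%:R).
Proof.
have := line_prob_ratio n 0; rewrite addr0 add0r => H.
rewrite /= (_ : 0 - 1 - 1 = (- 2%:R)%R :> int) //.
rewrite (_ : 0 - 1 + 1 = 0%R :> int) //.
rewrite (_ : 0 + 1 - 1 = 0%R :> int) // (_ : 0 + 1 + 1 = 2%:R%R :> int) //.
rewrite line_probN.
have n2 : n.+2%:R != 0 :> R by rewrite pnatr_eq0.
apply: (mulIf n2); rewrite mulrA mulfVK //.
move: H; rewrite intrD -[n.+2%:R]natr1 -[n.+1%:R]natr1 -pmulrn.
move: (line_prob n 2) (line_prob n 0) => A B.
move=> H; lra.
Qed.

(** Wallis-type bounds: by [line_prob_centreSS] the square is multiplied by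
    ((2n+1)/(2n+2))^2 at each step, which lies between the ratios
    (4n+1)/(4n+5) and (2n+1)/(2n+3). *)
Lemma line_prob_centre_bounds n :
  1 <= (4 * n%:R + 1) * line_prob n.*2 0 ^+ 2 /\
  (2 * n%:R + 1) * line_prob n.*2 0 ^+ 2 <= 1.
Proof.
elim: n => [|n [IH1 IH2]]; first by rewrite /= !mulr0 !add0r expr1n mulr1.
rewrite doubleS line_prob_centreSS exprMn.
move: (line_prob _ _ ^+ 2) (sqr_ge0 (line_prob n.*2 0)) IH1 IH2 => q q0.
rewrite -[n.+1]addn1 natrD -[n.*2.+2]addn2 -[n.*2.+1]addn1 !natrD.
rewrite -muln2 natrM; move: n%:R (ler0n R n) => x x0.
have -> : ((x * 2 + 1) / (x * 2 + 2)) ^+ 2 =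
  ((x * 2 + 1) ^+ 2) / ((x * 2 + 2) ^+ 2) by field; lra.
move=> H1 H2.
have D : 0 < (x * 2 + 2) ^+ 2 by rewrite exprn_gt0 //; lra.
split; rewrite !mulrA.
  rewrite ler_pdivlMr // mul1r.
  have : 1 * (x * 2 + 2) ^+ 2 <= ((4 * x + 1) * q) * (x * 2 + 2) ^+ 2.
    by rewrite ler_pM2r.
  nra.
rewrite ler_pdivrMr // mul1r.
have : ((2 * x + 1) * q) * ((x * 2 + 3) * (x * 2 + 1)) <=
   1 * ((x * 2 + 3) * (x * 2 + 1)).
  rewrite ler_wpM2r //; nra.
nra.
Qed.

End Line.

Arguments line_prob {R} n%_N u%_R.

(** * Neighbours and averages on the square lattice *)

Definition nbrs (x : Z2) : seq Z2 :=
  [:: (x.1 + 1, x.2); (x.1 - 1, x.2); (x.1, x.2 + 1); (x.1, x.2 - 1)].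

Lemma mem_nbrs x y : (y \in nbrs x) = neighbour x y.
Proof.
case: x y => [x1 x2] [y1 y2]; rewrite !inE /neighbour !xpair_eqE /=.
by apply/idP/idP; lia.
Qed.

Lemma nbrs_uniq x : uniq (nbrs x).
Proof.
by case: x => x1 x2; rewrite /= !inE !xpair_eqE !negb_or /= -!andbA; lia.
Qed.

Lemma Z2_nbr_ind (Q : Z2 -> Prop) :
  Q 0 -> (forall x z, z \in nbrs x -> Q x -> Q z) -> forall x, Q x.
Proof.
move=> Q0 QS [a b].
have Qa : Q (a, 0).
  elim/int_rect: a => [//|n IH|n IH]; apply: QS IH;
    rewrite !inE !xpair_eqE /=; lia.
elim/int_rect: b => [//|n IH|n IH]; apply: QS IH;
  rewrite !inE !xpair_eqE /=; lia.
Qed.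

Section Plane.
Variable R : realType.
Implicit Types (f g : Z2 -> R) (x y z : Z2).

Definition avg f x : R := 4^-1 * \sum_(z <- nbrs x) f z.

Lemma eq_avg f g x : (forall z, f z = g z) -> avg f x = avg g x.
Proof. by move=> fg; rewrite /avg; under eq_bigr do rewrite fg. Qed.

Lemma avgD f g x : avg (fun z => f z + g z) x = avg f x + avg g x.
Proof. by rewrite /avg big_split mulrDr. Qed.

Lemma avgB f g x : avg (fun z => f z - g z) x = avg f x - avg g x.
Proof. by rewrite /avg sumrB mulrBr. Qed.

Lemma avgMr f c x : avg (fun z => f z * c) x = avg f x * c.
Proof. by rewrite /avg -mulr_suml mulrA. Qed.

Lemma avg_cst c x : avg (fun=> c) x = c.
Proof.
rewrite /avg !big_cons big_nil.
lra.
Qed.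

Lemma avg_sum (I : Type) (r : seq I) (F : I -> Z2 -> R) x :
  avg (fun z => \sum_(i <- r) F i z) x = \sum_(i <- r) avg (F i) x.
Proof. by rewrite /avg exchange_big -mulr_sumr. Qed.

Lemma avg_le f g x : (forall z, f z <= g z) -> avg f x <= avg g x.
Proof. by move=> fg; rewrite ler_wpM2l // ler_sum. Qed.

Lemma avg_ge0 f x : (forall z, z \in nbrs x -> 0 <= f z) -> 0 <= avg f x.
Proof. by move=> f0; rewrite /avg big_seq mulr_ge0 // sumr_ge0. Qed.

Lemma avg_shift f x y : avg (fun z => f (z - y)) x = avg f (x - y).
Proof.
case: x y => [x1 x2] [y1 y2]; rewrite /avg !big_cons !big_nil /=.
have E u v : (u, v) - (y1, y2) = (u - y1, v - y2) by [].
by rewrite !E /= [x1 + 1 - _]addrAC [x1 - 1 - _]addrAC [x2 + 1 - _]addrAC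
  [x2 - 1 - _]addrAC.
Qed.

(** A Harnack-type bound: it turns an upper bound at a site into one at the
    neighbouring sites. *)
Lemma nbr_le_4avg f x z :
  (forall y, y \in nbrs x -> 0 <= f y) -> z \in nbrs x -> f z <= 4 * avg f x.
Proof.
move=> f0 zx; rewrite /avg mulVKf // big_seq (big_rem z) //= zx lerDl.
by rewrite sumr_ge0.
Qed.

(** * Return probabilities of the planar walk *)

(** The probability that the walk started at [x] is at the origin at time [n],
    computed by conditioning on the first step; [srw_law0] relates it to the
    process. *)
Fixpoint ret_prob n x : R :=
  if n is m.+1 then avg (ret_prob m) x else (x == 0)%:R.

(** A step of the planar walk moves x1 + x2 and x1 - x2 by independent signs. *)
Lemma ret_prob_line n x :
  ret_prob n x = line_prob n (x.1 + x.2) * line_prob n (x.1 - x.2).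
Proof.
elim: n x => [|n IH] [x1 x2] /=.
  rewrite -natrM mulnb; congr (nat_of_bool _)%:R.
  by rewrite xpair_eqE /=; lia.
rewrite /avg !big_cons big_nil !IH /=.
rewrite (_ : x1 + 1 + x2 = x1 + x2 + 1); last by ring.
rewrite (_ : x1 + 1 - x2 = x1 - x2 + 1); last by ring.
rewrite (_ : x1 - 1 + x2 = x1 + x2 - 1); last by ring.
rewrite (_ : x1 - 1 - x2 = x1 - x2 - 1); last by ring.
rewrite (_ : x1 + (x2 + 1) = x1 + x2 + 1); last by ring.
rewrite (_ : x1 - (x2 + 1) = x1 - x2 - 1); last by ring.
rewrite (_ : x1 + (x2 - 1) = x1 + x2 - 1); last by ring.
rewrite (_ : x1 - (x2 - 1) = x1 - x2 + 1); last by ring.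
by field.
Qed.

Lemma ret_prob_ge0 n x : 0 <= ret_prob n x.
Proof. by rewrite ret_prob_line mulr_ge0 ?line_prob_ge0. Qed.

Lemma ret_probN n x : ret_prob n (- x) = ret_prob n x.
Proof.
rewrite !ret_prob_line /= -(line_probN _ n (x.1 + x.2)).
by rewrite -(line_probN _ n (x.1 - x.2)) !opprD.
Qed.

Definition even_site x : bool := (2 %| x.1 + x.2)%Z.

Lemma even_site_nbr x z : z \in nbrs x -> even_site z = ~~ even_site x.
Proof.
case: x z => [x1 x2] [z1 z2]; rewrite !inE !xpair_eqE /even_site /=.
move=> H; apply/idP/idP; lia.
Qed.

Lemma ret_prob0_odd n : odd n -> ret_prob n 0 = 0.
Proof.
by move=> n2; rewrite ret_prob_line line_prob_parity ?mul0r //=; lia.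
Qed.

(** For even [n] both factors in [ret_prob_line] are largest at the centre, and
    for odd [n] both sides vanish. At odd sites the inequality can fail for odd
    [n], which is why the two parities are treated apart below. *)
Lemma ret_prob_le_centre n x : even_site x -> ret_prob n x <= ret_prob n 0.
Proof.
move=> x2; have [n2|n2] := boolP (odd n).
  rewrite ret_prob0_odd // ret_prob_line line_prob_parity ?mul0r //.
  by move: x2; rewrite /even_site; lia.
by rewrite !ret_prob_line ler_pM ?line_prob_ge0 // line_prob_le_centre.
Qed.

Lemma ret_prob0_double n : ret_prob n.*2 0 = line_prob n.*2 0 ^+ 2.
Proof. by rewrite ret_prob_line. Qed.

Lemma ret_prob0_le n : ret_prob n 0 <= n.+1%:R^-1.
Proof.
have [n2|n2] := boolP (odd n).
  by rewrite ret_prob0_odd // invr_ge0.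
rewrite -(even_halfK n2) ret_prob0_double.
have [_ ] := line_prob_centre_bounds R n./2.
rewrite -[n./2.*2.+1]addn1 natrD -[in _.*2%:R]muln2 natrM [2 * _]mulrC => H.
have D : 0 < n./2%:R * 2 + 1 :> R by rewrite ltr_wpDl // mulr_ge0.
by rewrite -(ler_pM2l D) mulfV // gt_eqF.
Qed.

Lemma ret_prob0_cvg0 : ret_prob n 0 @[n --> \oo] --> (0 : R).
Proof.
apply: (@squeeze_cvgr _ _ _ _ (cst 0) (@harmonic R)).
- by near=> n; rewrite ret_prob_ge0 ret_prob0_le.
- exact: cvg_cst.
- exact: cvg_harmonic.
Unshelve. all: end_near. Qed.

Definition expected_visits N x : R := \sum_(0 <= k < N) ret_prob k x.

Lemma expected_visits_ge0 N x : 0 <= expected_visits N x.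
Proof. by apply: sumr_ge0 => k _; exact: ret_prob_ge0. Qed.

(** This is where the dimension enters: p_{2n}(0) is at least of order 1/n. *)
Lemma expected_visits_double_ge N :
  series harmonic N <= 4 * expected_visits N.*2 0.
Proof.
elim: N => [|N IH].
  by rewrite /expected_visits /series /= !big_geq // mulr0.
rewrite seriesSr -[harmonic N]/(N.+1%:R^-1).
rewrite /expected_visits doubleS !big_nat_recr //.
have h : N.+1%:R^-1 <= 4 * ret_prob N.*2 0.
  have [H _] := line_prob_centre_bounds R N.
  have N0 : 0 < N.+1%:R :> R by [].
  rewrite ret_prob0_double -(ler_pM2l N0) mulfV ?gt_eqF //.
  apply: le_trans H _; rewrite -[N.+1]addn1 natrD [leRHS]mulrA.
  by rewrite ler_wpM2r ?sqr_ge0 // mulrDl; lra.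
have := ret_prob_ge0 N.*2.+1 0; move: IH; rewrite /expected_visits.
move: (ret_prob N.*2 0) (ret_prob N.*2.+1 0) h => A B.
move: (N.+1%:R^-1) => C; move: (series _ _) (\sum_(0 <= k < N.*2) _).
move=> U V /=; lra.
Qed.

Lemma expected_visits_unbounded (M : R) : exists N, M < expected_visits N 0.
Proof.
apply: contrapT => H; apply: (@dvg_harmonic R).
apply: nondecreasing_is_cvgn.
  by apply: nondecreasing_series => k _ _; exact: harmonic_ge0.
exists (4 * M) => _ [N _ <-]; apply: le_trans (expected_visits_double_ge N) _.
rewrite ler_pM2l // leNgt; apply/negP => h; apply: H.
by exists N.*2.
Qed.

(** * The potential kernel *)

Definition potential_upto N x : R :=
  \sum_(0 <= k < N) (ret_prob k 0 - ret_prob k x).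

Lemma potential_uptoE N x :
  potential_upto N x = expected_visits N 0 - expected_visits N x.
Proof. exact: sumrB. Qed.

Lemma expected_visitsS N x :
  expected_visits N.+1 x = (x == 0)%:R + avg (expected_visits N) x.
Proof. by rewrite /expected_visits big_nat_recl //= avg_sum. Qed.

Lemma potential_uptoS N x :
  potential_upto N.+1 x
  = avg (potential_upto N) x + ret_prob N 0 - (x == 0)%:R.
Proof.
rewrite potential_uptoE [expected_visits _ x]expected_visitsS.
rewrite {1}/expected_visits big_nat_recr //=.
rewrite (eq_avg (f := potential_upto N)
  (g := fun z => expected_visits N 0 - expected_visits N z)).
  by rewrite avgB avg_cst -/(expected_visits N 0); ring.
by move=> z; rewrite potential_uptoE.
Qed.

Lemma potential_upto_even_nd x :
  even_site x -> nondecreasing_seq (potential_upto ^~ x).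
Proof.
move=> x2; apply/nondecreasing_seqP => N.
by rewrite /potential_upto big_nat_recr //= lerDl subr_ge0 ret_prob_le_centre.
Qed.

Lemma potential_upto_ge0 N x : 0 <= potential_upto N x.
Proof.
have E y M : even_site y -> 0 <= potential_upto M y.
  move=> y2; have := potential_upto_even_nd y2 (leq0n M).
  by rewrite {1}/potential_upto big_geq.
have [|x2] := boolP (even_site x); first exact: E.
case: N => [|N]; first by rewrite /potential_upto big_geq.
have x0 : x == 0 = false by apply: contraNF x2 => /eqP ->.
rewrite potential_uptoS x0 subr0 addr_ge0 ?ret_prob_ge0 //.
by apply: avg_ge0 => z zx; apply: E; rewrite (even_site_nbr zx).
Qed.

(** Since [potential_upto N] is nonnegative, its value at a neighbour of [x] is
    at most four times its average around [x], which [potential_uptoS] compares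
    with its value at [x] itself. Bounds thus spread from the origin, where
    [potential_upto] vanishes. *)
Lemma potential_upto_bounded x : exists C, forall N, potential_upto N x <= C.
Proof.
elim/Z2_nbr_ind: x => [|x z zx [C HC]].
  exists 0 => N; rewrite /potential_upto big1 // => k _; exact: subrr.
exists (4 * (C + 1)) => N.
have := nbr_le_4avg (fun y _ => potential_upto_ge0 N y) zx.
move=> /le_trans; apply; rewrite ler_pM2l //.
have := HC N.+1; rewrite potential_uptoS.
have := ret_prob_ge0 N 0.
have : (x == 0)%:R <= 1 :> R by rewrite lern1 leq_b1.
lra.
Qed.

Lemma avg_cvg (f : nat -> Z2 -> R) (l : Z2 -> R) x :
  (forall z, z \in nbrs x -> f N z @[N --> \oo] --> l z) ->
  avg (f N) x @[N --> \oo] --> avg l x.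
Proof.
move=> H; apply: cvgMr.
elim: (nbrs x) H => [|z s IH] H.
  by rewrite big_nil; under eq_fun do rewrite big_nil; exact: cvg_cst.
rewrite big_cons; under eq_fun do rewrite big_cons.
apply: cvgD; first by apply: H; rewrite mem_head.
by apply: IH => y ys; apply: H; rewrite in_cons ys orbT.
Qed.

Definition potential x : R := limn (potential_upto ^~ x).

Lemma potential_upto_cvg_even x : even_site x ->
  potential_upto N x @[N --> \oo] --> potential x.
Proof.
move=> x2; apply: nondecreasing_is_cvgn; first exact: potential_upto_even_nd.
by have [C HC] := potential_upto_bounded x; exists C => _ [N _ <-].
Qed.

(** Besides convergence at odd sites, this gives the harmonicity of [potential]
    there. *)
Lemma potential_upto_cvg_odd x : ~~ even_site x ->
  potential_upto N x @[N --> \oo] --> avg potential x.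
Proof.
move=> x2; rewrite -cvg_shiftS /=.
have x0 : x == 0 = false by apply: contraNF x2 => /eqP ->.
under eq_fun do rewrite potential_uptoS x0 subr0.
rewrite -[avg potential x]addr0; apply: cvgD; last exact: ret_prob0_cvg0.
apply: avg_cvg => z zx.
by apply: potential_upto_cvg_even; rewrite (even_site_nbr zx).
Qed.

Lemma potential_upto_cvg x : potential_upto N x @[N --> \oo] --> potential x.
Proof.
have [x2|x2] := boolP (even_site x); first exact: potential_upto_cvg_even.
by apply: cvgP; exact: potential_upto_cvg_odd.
Qed.

Lemma potential_ge0 x : 0 <= potential x.
Proof.
apply: cvgr_to_ge (@potential_upto_cvg x) _.
by apply: nearW => N; exact: potential_upto_ge0.
Qed.

(** At time 0 only the walk started at the origin is there, so the first term of
    a nondecreasing sequence of partial sums is already 1. *)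
Lemma potential_even_gt0 x : even_site x -> x != 0 -> 0 < potential x.
Proof.
move=> x2 x0; apply: (@lt_le_trans _ _ 1) => //.
have -> : 1 = potential_upto 1 x.
  by rewrite /potential_upto big_nat1 /= (negbTE x0) subr0.
apply: nondecreasing_cvgn_le; first exact: potential_upto_even_nd.
exact: cvgP (@potential_upto_cvg x).
Qed.

Lemma potential_gt0 x : x != 0 -> 0 < potential x.
Proof.
move=> x0; have [x2|x2] := boolP (even_site x); first exact: potential_even_gt0.
have -> : potential x = avg potential x.
  exact: cvg_lim (@potential_upto_cvg_odd x x2).
suff [z zx z0] : exists2 z, z \in nbrs x & z != 0.
  have : 0 < potential z.
    by apply: potential_even_gt0; rewrite ?(even_site_nbr zx).
  have := nbr_le_4avg (fun y _ => potential_ge0 y) zx.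
  lra.
case: x x0 {x2} => a b; rewrite !xpair_eqE /= => ab.
(* At least one of the two horizontal neighbours is not the origin. *)
have [a1|a1] := eqVneq a (-1).
  by exists (a - 1, b); rewrite ?inE ?eqxx ?orbT // xpair_eqE; lia.
by exists (a + 1, b); rewrite ?inE ?eqxx ?orbT // xpair_eqE /=; lia.
Qed.

(** * The walk killed at the origin *)

(** The probability that the walk started at [x] is at [y] at time [n] without
    having visited the origin up to then. *)
Fixpoint killed_prob y n x : R :=
  if x == 0 then 0
  else if n is m.+1 then avg (killed_prob y m) x else (x == y)%:R.

(** The probability that the walk started at [x] first visits the origin at time
    [n], time 0 included. *)
Fixpoint hit_prob n x : R :=
  if x == 0 then (n == 0)%:R
  else if n is m.+1 then avg (hit_prob m) x else 0.

Lemma killed_prob0 y n : killed_prob y n 0 = 0.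
Proof. by case: n. Qed.

Lemma hit_prob_ge0 n x : 0 <= hit_prob n x.
Proof.
by elim: n x => [|n IH] x /=; case: ifP => // _; rewrite ?ler0n // avg_ge0.
Qed.

Lemma hit_prob_origin n : hit_prob n.+1 0 = 0.
Proof. by []. Qed.

Lemma sum_hit_prob_le1 N x : \sum_(0 <= j < N) hit_prob j x <= 1.
Proof.
elim: N x => [|N IH] x; first by rewrite big_geq.
rewrite big_nat_recl //=; have [_|_] := eqVneq x 0.
  by rewrite big1 // addr0.
by rewrite add0r -avg_sum -[leRHS](avg_cst 1 x) avg_le.
Qed.

(** Either the walk has avoided the origin so far, or it restarts from there
    after its first visit at time [j]. *)
Lemma first_visit_renewal y n x :
  ret_prob n (x - y)
  = killed_prob y n x + \sum_(0 <= j < n.+1) hit_prob j x * ret_prob (n - j) y.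
Proof.
elim: n x => [|n IH] x; have [->|x0] := eqVneq x 0.
- rewrite sub0r ret_probN killed_prob0 big_nat1 subnn [hit_prob 0 0]/=.
  by rewrite mul1r add0r.
- by rewrite big_nat1 /= (negbTE x0) mul0r addr0 subr_eq0.
- rewrite sub0r ret_probN killed_prob0 big_nat_recl // [hit_prob 0 0]/= subn0.
  by rewrite big1 ?addr0 ?mul1r ?add0r // => j _; rewrite hit_prob_origin mul0r.
rewrite big_nat_recl //= (negbTE x0) mul0r add0r -avg_shift.
rewrite (eq_avg x (IH : forall z, _ = _)) avgD avg_sum; congr (_ + _).
apply: eq_bigr => j _; exact: avgMr.
Qed.

Lemma expected_visits_renewal y N x :
  expected_visits N (x - y)
  = \sum_(0 <= k < N) killed_prob y k x
    + \sum_(0 <= j < N) hit_prob j x * expected_visits (N - j) y.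
Proof.
rewrite /expected_visits -sum_convolution -big_split /=.
by apply: eq_bigr => n _; exact: first_visit_renewal.
Qed.

Lemma killed_prob_target0 n x : killed_prob 0 n x = 0.
Proof.
elim: n x => [|n IH] x /=; first by case: (x == 0).
by rewrite (eq_avg x IH) avg_cst if_same.
Qed.

Lemma expected_visits_first_hit N x :
  expected_visits N x
  = \sum_(0 <= j < N) hit_prob j x * expected_visits (N - j) 0.
Proof.
have := expected_visits_renewal 0 N x; rewrite subr0 => ->.
by rewrite big1 ?add0r // => k _; exact: killed_prob_target0.
Qed.

Lemma expected_visits_nd x : nondecreasing_seq (expected_visits ^~ x).
Proof.
apply/nondecreasing_seqP => N.
by rewrite /expected_visits big_nat_recr //= lerDl ret_prob_ge0.
Qed.

(** Recurrence. If the origin were visited with probability L < 1 from [x], then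
    G_N(x) <= L G_N(0), so (1 - L) G_N(0) <= a_N(x) would be bounded in [N],
    whereas G_N(0) is not. *)
Lemma sum_hit_prob_cvg1 x :
  \sum_(0 <= j < N) hit_prob j x @[N --> \oo] --> (1 : R).
Proof.
set F := fun N : nat => _.
have Fnd : nondecreasing_seq F.
  apply/nondecreasing_seqP => N.
  by rewrite /F big_nat_recr //= lerDl hit_prob_ge0.
have Fcvg : cvgn F.
  apply: nondecreasing_is_cvgn => //; exists 1 => _ [N _ <-].
  exact: sum_hit_prob_le1.
suff L1 : 1 <= limn F.
  have -> : 1 = limn F; last by [].
  apply/eqP; rewrite eq_le L1 /=.
  by apply: limr_le => //; apply: nearW => N; exact: sum_hit_prob_le1.
rewrite leNgt; apply/negP => L1.
have [C HC] := potential_upto_bounded x.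
have [N HN] := expected_visits_unbounded (C / (1 - limn F)).
have : expected_visits N x <= F N * expected_visits N 0.
  rewrite expected_visits_first_hit mulr_suml; apply: ler_sum => j _.
  by rewrite ler_wpM2l ?hit_prob_ge0 // expected_visits_nd // leq_subr.
have := HC N; rewrite potential_uptoE.
have FL : F N <= limn F by exact: nondecreasing_cvgn_le.
have : F N * expected_visits N 0 <= limn F * expected_visits N 0.
  by rewrite ler_wpM2r ?expected_visits_ge0.
move: HN; rewrite ltr_pdivrMr ?subr_gt0 // mulrBr mulr1 mulrC.
lra.
Qed.

(** In [expected_visits_renewal], writing G = G(0) - a_N leaves
    the convolution of the f_j with G(0), which is G_N(x) by
    [expected_visits_first_hit]. *)
Lemma sum_killed_prob N y x :
  \sum_(0 <= k < N) killed_prob y k x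
  = potential_upto N x - potential_upto N (x - y)
    + \sum_(0 <= j < N) hit_prob j x * potential_upto (N - j) y.
Proof.
have := expected_visits_renewal y N x.
under [X in _ = _ + X]eq_bigr => j _.
  rewrite -[expected_visits _ y](subKr (expected_visits (N - j) 0)).
  rewrite -potential_uptoE mulrBr.
  over.
rewrite sumrB -expected_visits_first_hit !potential_uptoE; lra.
Qed.

Lemma sum_killed_prob_cvg y x :
  \sum_(0 <= k < N) killed_prob y k x @[N --> \oo]
  --> potential x + potential y - potential (x - y).
Proof.
under eq_fun do rewrite sum_killed_prob.
rewrite addrAC; apply: cvgD.
  by apply: cvgB; exact: potential_upto_cvg.
apply: convolution_cvg (@sum_hit_prob_cvg1 x) (@potential_upto_cvg y) => j.
exact: hit_prob_ge0.
Qed.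

End Plane.

(** * Laws of Markov chains with finitely many possible jumps *)

Section MarkovChain.
Variables (R : realType) (E : countType) (p : E -> E -> R).
Variable nb : E -> seq E.
Hypothesis nb_uniq : forall x, uniq (nb x).
Hypothesis p_nb : forall x y, y \notin nb x -> p x y = 0.

Fixpoint nstep_prob (y : E) n (x : E) : R :=
  if n is m.+1 then \sum_(z <- nb x) p x z * nstep_prob y m z
  else (x == y)%:R.

Variables (d : measure_display) (T : measurableType d).
Variables (P : E -> probability T R) (S : nat -> T -> E).
Hypothesis chain : markov_chain p P S.
Implicit Types (x y z : E) (s : nat -> E).

Let set_at s m z : nat -> E := fun k => if k == m then z else s k.

Lemma path_event_set_at n s z :
  path_event S n.+1 (set_at s n.+1 z)
  = path_event S n s `&` S n.+1 @^-1` [set z].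
Proof.
apply/seteqP; split => [w H|w [H Hz]].
  split; last by have := H n.+1 (leqnn _); rewrite /set_at eqxx.
  by move=> k kn; have := H k (leqW kn); rewrite /set_at ltn_eqF.
move=> k; rewrite leq_eqVlt /set_at => /predU1P[->|kn]; first by rewrite eqxx.
by rewrite ltn_eqF //; apply: H.
Qed.

Lemma measurable_path_event n s : measurable (path_event S n s).
Proof.
have [mS _ _] := chain; elim: n => [|n IH].
  rewrite (_ : path_event _ _ _ = S 0%N @^-1` [set s 0%N]) //.
  apply/seteqP; split => [w /(_ 0%N)|w H k]; first exact.
  by rewrite leqn0 => /eqP ->.
rewrite (_ : s = set_at s n.+1 (s n.+1)); last first.
  by apply/funext => k; rewrite /set_at; case: eqP => // ->.
by rewrite path_event_set_at; apply: measurableI.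
Qed.

Lemma path_event_step x n s z :
  P x (path_event S n s `&` S n.+1 @^-1` [set z])
  = (P x (path_event S n s) * (p (s n) z)%:E)%E.
Proof.
have [_ _ mk] := chain; rewrite -path_event_set_at mk.
congr (P x _ * (p _ _)%:E)%E.
- apply/seteqP; split => w H k kn; have := H k kn;
  by rewrite /set_at ltn_eqF.
- by rewrite /set_at ltn_eqF.
- by rewrite /set_at eqxx.
Qed.

(** The chain takes countably many values, so the jumps of probability zero
    together form a null event; this keeps all transition sums finite. *)
Lemma jump_outside_nb_null x n s (B : set T) :
  measurable B -> B `<=` path_event S n s ->
  (forall w, B w -> S n.+1 w \notin nb (s n)) -> P x B = 0%E.
Proof.
move=> mB BA Bnb; have [mS _ _] := chain.
apply/(measure_negligible mB).
pose F i : set T := if unpickle i is Some z then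
  if z \in nb (s n) then set0 else path_event S n s `&` S n.+1 @^-1` [set z]
  else set0.
apply: (@negligibleS _ _ _ _ (\bigcup_i F i)).
  move=> w Bw; exists (pickle (S n.+1 w)) => //.
  by rewrite /F pickleK (negbTE (Bnb _ Bw)); split => //; exact: BA.
apply: negligible_bigcup => i; rewrite /F.
case: (unpickle i) => [z|]; last exact: negligible_set0.
case: ifPn => [_|znb]; first exact: negligible_set0.
apply/negligibleP.
  by apply: measurableI => //; exact: measurable_path_event.
by apply: etrans (path_event_step _ _ _ _) _; rewrite p_nb // mule0.
Qed.

(** The Markov property for the future at distance [k]. The induction on [k]
    splits off the next step, which extends the prescribed path by one site;
    hence [n] and [s] must vary. *)
Lemma path_event_nstep_prob x y k n s :
  P x (path_event S n s `&` S (n + k)%N @^-1` [set y])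
  = (P x (path_event S n s) * (nstep_prob y k (s n))%:E)%E.
Proof.
have [mS _ _] := chain.
elim: k n s => [|k IH] n s /=.
  rewrite addn0; have [<-|sy] := eqVneq (s n) y.
    by rewrite mule1 setIidl // => w /(_ n (leqnn n)).
  rewrite mule0 (_ : _ `&` _ = set0) ?measure0 //.
  apply/seteqP; split => // w [/(_ n (leqnn n)) Sn /= Sy].
  by move: sy; rewrite -Sn Sy eqxx.
set A := path_event S n s; set B := S _ @^-1` _.
have mA : measurable A by exact: measurable_path_event.
have mAB : measurable (A `&` B) by apply: measurableI => //; exact: mS.
pose F z := A `&` S n.+1 @^-1` [set z] `&` B.
have mF z : measurable (F z).
  by apply: measurableI; [apply: measurableI|]; by [|exact: mS].
pose U := \bigcup_(z in [set` nb (s n)]) F z.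
have mU : measurable U by apply: fin_bigcup_measurable.
have UAB : U `<=` A `&` B by move=> w [z _ [[]]].
rewrite -(setDUK UAB) measureU0 //; first last.
- apply: (@jump_outside_nb_null x n s); first exact: measurableD.
    by move=> w [[]].
  move=> w [[Aw Bw] Uw]; apply/negP => nbw; apply: Uw.
  by exists (S n.+1 w).
- exact: measurableD.
have Ftriv : trivIset [set` nb (s n)] F.
  by move=> z1 z2 _ _ [w [[[_ /= <-] _] [[_ /= <-] _]]].
have nbfin : finite_set [set` nb (s n)] by exact: finite_seq.
rewrite (measure_fin_bigcup _ nbfin Ftriv (fun z _ => mF z)).
rewrite -(fsbig_seq _ _ (nb_uniq (s n))).
rewrite -sumEFin fin_num_sume_distrr; first last.
- by move=> z1 z2 _ _; exact: fin_num_adde_defl.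
- exact: fin_num_measure.
apply: eq_bigr => z _.
rewrite -[LHS]/(P x (F z)) /F /A /B -path_event_set_at addnS -[(n + k).+1]addSn.
rewrite IH path_event_set_at path_event_step.
by rewrite /set_at eqxx EFinM muleA.
Qed.

Lemma chain_law x y n : P x (S n @^-1` [set y]) = (nstep_prob y n x)%:E.
Proof.
have [mS P1 _] := chain.
have E0 : path_event S 0 (fun=> x) = S 0%N @^-1` [set x].
  apply/seteqP; split => [w /(_ 0%N)|w H k]; first exact.
  by rewrite leqn0 => /eqP ->.
have := path_event_nstep_prob x y n 0 (fun=> x).
rewrite E0 add0n P1 mul1e => <-.
rewrite (measureDI (P x) (mS n y) (mS 0%N x)) setIC -[RHS]add0e.
congr (_ + _)%E.
apply: (@subset_measure0 _ _ _ _ _ (~` (S 0%N @^-1` [set x]))) => //.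
- by apply: measurableD; exact: mS.
- by apply: measurableC; exact: mS.
- by apply: etrans (probability_setC _ (mS 0%N x)) _; rewrite P1 subee.
Qed.

Lemma green_cvg x y (g : R) :
  \sum_(0 <= k < n) nstep_prob y k x @[n --> \oo] --> g -> green P S x y = g%:E.
Proof.
move=> ng; have [mS _ _] := chain.
pose f k : T -> \bar R := fun w => (\1_(S k @^-1` [set y]) w)%:E.
have mf k : measurable_fun setT (f k).
  by apply/measurable_EFinP; exact: measurable_indic (mS k y).
rewrite /green (integral_nneseries _ measurableT mf); last first.
  by move=> k w _; rewrite lee_fin.
have intf k : (\int[P x]_w f k w = (nstep_prob y k x)%:E)%E.
  by rewrite integral_indic // setIT -chain_law.
under eq_eseriesr => k _ do rewrite intf.
under eq_fun do rewrite sumEFin.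
by apply/cvg_lim => //; apply: cvg_EFin; [exact: nearW|].
Qed.

End MarkovChain.

(** * The potential kernel of the simple random walk *)

Section SimpleRandomWalk.
Variables (R : realType) (d : measure_display) (T : measurableType d).
Variables (P : Z2 -> probability T R) (S : nat -> T -> Z2).
Hypothesis srw : simple_random_walk P S.

Lemma srw_law0 k x : P x (S k @^-1` [set 0]) = (ret_prob R k x)%:E.
Proof.
have H x' y : y \notin nbrs x' -> srw_kernel R x' y = 0.
  by rewrite mem_nbrs /srw_kernel => /negbTE ->.
rewrite (chain_law nbrs_uniq H srw); congr _%:E.
elim: k x => [//|k IH] x /=.
rewrite /avg mulr_sumr !big_seq; apply: eq_bigr => z.
by rewrite mem_nbrs /srw_kernel IH => ->.
Qed.

Lemma potential_kernelE x : potential_kernel P S x = potential R x.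
Proof.
rewrite /potential_kernel /potential; congr (limn _); apply/funext => N.
by apply: eq_bigr => k _; rewrite !srw_law0.
Qed.

End SimpleRandomWalk.

(** * The conditioned walk as a Doob transform *)

Section ConditionedWalk.
Variable R : realType.
Local Notation a := (potential R).

Definition nbrs_star (x : Z2star) : seq Z2star := pmap insub (nbrs (val x)).

Lemma mem_nbrs_star x y : (y \in nbrs_star x) = neighbour (val x) (val y).
Proof. by rewrite mem_pmap_sub mem_nbrs. Qed.

Lemma nbrs_star_uniq x : uniq (nbrs_star x).
Proof. by apply: pmap_sub_uniq; exact: nbrs_uniq. Qed.

Lemma conditioned_nstep_prob y n x :
  nstep_prob (conditioned_kernel a) nbrs_star y n x
  = a (val y) / a (val x) * killed_prob R (val y) n (val x).
Proof.
have a0 (z : Z2star) : a (val z) != 0.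
  by rewrite gt_eqF ?potential_gt0 ?(valP z).
elim: n x => [|n IH] x /=; rewrite (negbTE (valP x)).
  rewrite val_eqE; case: eqP => [->|_]; last by rewrite mulr0.
  by rewrite mulr1 divff //; exact: a0.
rewrite big_pmap /avg mulrA mulr_sumr !big_seq; apply: eq_bigr => z.
rewrite mem_nbrs => xz; case: insubP => [u _ uz|/=]; last first.
  (* The neighbour 0 has no counterpart in Z2star, and the killed walk gives it
     no weight. *)
  by rewrite negbK => /eqP ->; rewrite killed_prob0 mulr0.
rewrite /= IH /conditioned_kernel uz xz -uz; field.
by rewrite !a0.
Qed.

End ConditionedWalk.

(** * The Green's function of the conditioned walk *)

Unset Implicit Arguments.

Theorem theorem1p1 (R : realType)
    (d : measure_display) (T : measurableType d)
    (P : Z2 -> probability T R) (S : nat -> T -> Z2)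
    (d' : measure_display) (T' : measurableType d')
    (Phat : Z2star -> probability T' R) (Shat : nat -> T' -> Z2star) :
  simple_random_walk P S ->
  let a := potential_kernel P S in
  conditioned_walk a Phat Shat ->
  forall x y : Z2star,
    green Phat Shat x y
    = (a (val y) / a (val x)
       * (a (val x) + a (val y) - a (val x - val y)))%:E.
Proof.
move=> srw a; have -> : a = potential R.
  by apply/funext => x; exact: potential_kernelE.
move=> cond x y.
have H (u v : Z2star) : v \notin nbrs_star u ->
    conditioned_kernel (potential R) u v = 0.
  by rewrite mem_nbrs_star /conditioned_kernel => /negbTE ->.
apply: (green_cvg nbrs_star_uniq H cond).
rewrite (_ : (fun N => _) = fun N => potential R (val y) / potential R (val x)
    * \sum_(0 <= k < N) killed_prob R (val y) k (val x)); last first.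
  apply/funext => N; rewrite mulr_sumr.
  by apply: eq_bigr => k _; exact: conditioned_nstep_prob.
by apply: cvgMr; exact: sum_killed_prob_cvg.
Qed.
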